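(* Let $\tau$ be an infinite cardinal number. For a (Hausdorff) topological space $X$, the following are equivalent: (a) $X$ is $\tau$-paracompact and normal. (b) If $E$ is a topological vector space with $d(E)\leq\tau$, then each convex-valued open relation $\Phi:X\leadsto E$ has a continuous selection.
   Context: All topological spaces are assumed Hausdorff. All vector spaces are real. A topological vector space is a vector space with a (Hausdorff) topology making the vector operations continuous (no local convexity is assumed). $d(Y)$ denotes the density of a space $Y$ (the least cardinality of a dense subset). A space $X$ is $\tau$-paracompact if each open cover of $X$ of cardinality $\leq\tau$ has a locally finite open refinement (covering $X$). For a relation $\Phi\subset X\times Y$, $\Phi(x)=\{y\in Y:\langle x,y\rangle\in\Phi\}$; writing $\Phi:X\leadsto Y$ means that $\Phi(x)\neq\varnothing$ for every $x\in X$. The relation $\Phi$ is open if it is an open subset of the product space $X\times Y$. It is convex-valued if each $\Phi(x)$ is convex. A selection for $\Phi:X\leadsto Y$ is a map $f:X\to Y$ with $f(x)\in\Phi(x)$ for every $x\in X$. *)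

(* Defs.v *)
From HB Require Import structures.
Set Warnings "-notation-overridden,-ambiguous-paths,-notation-incompatible-prefix".
From mathcomp Require Import all_boot all_order all_algebra.
From mathcomp Require Import boolp classical_sets functions cardinality.
From mathcomp Require Import reals convex topology normedtype.

Set Implicit Arguments.
Unset Strict Implicit.
Unset Printing Implicit Defensive.

Local Open Scope classical_set_scope.
Local Open Scope card_scope.

Definition open_cover (X : topologicalType) (U : set (set X)) :=
  U `<=` open /\ cover U id = [set: X].

Definition refines (X : Type) (V U : set (set X)) :=
  forall B, V B -> exists2 A, U A & B `<=` A.

Definition locally_finite (X : topologicalType) (V : set (set X)) :=
  forall x : X, exists2 N, nbhs x N & finite_set [set B | V B /\ B `&` N !=set0].

(* A cardinal is represented by a type K of that cardinality. *)
Definition tau_paracompact (K : Type) (X : topologicalType) :=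
  forall U : set (set X), open_cover U -> U #<= [set: K] ->
  exists V : set (set X),
    [/\ open_cover V, refines V U & locally_finite V].

(* The cardinality of D is the density of Y. *)
Definition has_density (Y : topologicalType) (D : set Y) :=
  dense D /\ forall D' : set Y, dense D' -> D #<= D'.

Definition density_le (Y : topologicalType) (K : Type) :=
  exists2 D : set Y, has_density D & D #<= [set: K].

Definition set_valued (X Y : Type) (Phi : set (X * Y)) :=
  forall x, xsection Phi x !=set0.

Definition convex_valued (R : realType) (X : Type) (E : lmodType R)
    (Phi : set (X * E)) :=
  forall x, convex_set (xsection Phi x : set (convex_lmodType E)).

Definition selection (X Y : Type) (Phi : set (X * Y)) (f : X -> Y) :=
  forall x, xsection Phi x (f x).

Lemma least_card_ex (Y : Type) (F : set (set Y)) : F !=set0 ->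
  exists2 A, F A & forall B, F B -> A #<= B.
Proof.
move=> [A0 FA0].
pose P : set (set (set Y -> Y)) := [set S |
  (forall f B, S f -> F B -> B (f B)) /\
  (forall f g B, S f -> S g -> F B -> f B = g B -> f = g)].
have [G GP Gtot|S [[SF Sinj] Smax]] := @Zorn_bigcup _ P.
  split=> [f B [S GS Sf] FB|f g B [S GS Sf] [S' GS' Sg] FB fg].
    by have [mem _] := GP _ GS; exact: (mem f B Sf FB).
  have [SS'|S'S] := Gtot _ _ GS GS'.
  - have [_ inj] := GP _ GS'.
    exact: (inj f g B (SS' _ Sf) Sg FB fg).
  - have [_ inj] := GP _ GS.
    exact: (inj f g B Sf (S'S _ Sg) FB fg).
have [[A FA SA]|nA] := pselect (exists2 A, F A &
    forall y, A y -> exists2 f, S f & f A = y).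
  exists A => // B FB.
  have /boolp.choice[e eP] :
      forall y, exists f : set Y -> Y, A y -> S f /\ f A = y.
    move=> y; have [/SA[f Sf fA]|nAy] := pselect (A y); first by exists f.
    by exists (fun=> y).
  have /injfunPex[f] : exists2 f : Y -> Y, set_fun A B f & set_inj A f.
    exists (fun y => e y B) => [y Ay|y z].
      by apply: SF FB; have [] := eP _ Ay.
    rewrite !inE => Ay Az /= eyz.
    have [Sy <-] := eP _ Ay; have [Sz <-] := eP _ Az.
    by rewrite (Sinj _ _ _ Sy Sz FB eyz).
  exact: inj_card_le f.
have miss A : F A -> exists2 y, A y & forall f, S f -> f A <> y.
  move=> FA; apply: contrapT => nex; apply: nA; exists A => // y Ay.
  apply: contrapT => nf; apply: nex; exists y => // f Sf fA.
  by apply: nf; exists f.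
have [y0 _ _] := miss _ FA0.
have /boolp.choice[g gP] : forall A, exists y,
    F A -> A y /\ forall f, S f -> f A <> y.
  move=> A; have [/miss[y Ay fy]|nFA] := pselect (F A); first by exists y.
  by exists y0.
have nSg : ~ S g.
  by move=> Sg; have [_ fg] := gP _ FA0; exact: (fg g Sg).
have /Smax[] : S `<` S `|` [set g].
  by split=> [f Sf|/(_ g) Sg]; [left|apply/nSg/Sg; right].
split=> [f B [Sf|->] FB|f h B [Sf|->] [Sh|->] FB].
- exact: (SF f B Sf FB).
- by have [] := gP _ FB.
- exact: (Sinj f h B Sf Sh FB).
- by have [_ fg] := gP _ FB; move=> /(fg _ Sf).
- by have [_ fg] := gP _ FB; move=> /esym/(fg _ Sh).
- by [].
Qed.

Lemma density_leP (Y : topologicalType) (K : Type) :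
  density_le Y K <-> exists2 D : set Y, dense D & D #<= [set: K].
Proof.
split=> [[D [dD _] DK]|[D dD DK]]; first by exists D.
have [|A dA Amin] := @least_card_ex Y [set D | dense D]; first by exists D.
by exists A; [split|exact: card_le_trans (Amin _ dD) DK].
Qed.

(* Main.v *)
Require Import Defs.
From HB Require Import structures.
From mathcomp Require Import finmap.
From mathcomp Require Import all_boot all_order all_algebra.
From mathcomp Require Import interval_inference lra.
From mathcomp Require Import boolp classical_sets functions cardinality fsbigop.
From mathcomp Require Import reals convex topology normedtype.

Set Implicit Arguments.
Unset Strict Implicit.
Unset Printing Implicit Defensive.

Import Order.TTheory GRing.Theory Num.Theory.

(** From covers to selections.  If [D] is dense in [E], the open values of [Phi]
    all meet [D], so the open sets of those [x] for which [d] belongs to [Phi x],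
    with [d] in [D], cover [X].  A locally finite refinement and a partition of
    unity subordinated to it turn the points [d] into a locally finite weighted
    average, which is continuous and takes its values in [Phi x] by convexity
    ([selection_of_locally_finite], [selection_of_paracompact]).  The partition of
    unity comes from Urysohn functions on a closed shrinking of the refinement;
    shrinking a point-finite open cover of a normal space is an application of
    Zorn's lemma ([shrinking]).

    From selections to normality.  Disjoint closed sets [A] and [B] are separated
    by a selection of a relation into the line whose values are below 0 on [A] and
    above 1 on [B] ([normal_of_selection]).

    From selections to covers.  Let [u] be an open cover indexed by [K], and [E] the
    space of finitely supported real functions on [K] with the l1 norm.  Over [x]
    lies the simplex [cover_simplex u x] spanned by the unit vectors [delta R k]
    with [u k x]; the vectors at distance less than 1/4 from it form an open
    relation with nonempty convex values.  Let [f] be a selection.  At [x], the mass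
    of [f x] on the indices [k] with [x] outside of [u k] is less than 1/4, while
    the norm of [f x] is at least 3/4.  Keep [x] in the [k]-th set of the new cover
    when [u k x] and the mass of [f x] above the height [`|f x k|] is less than 1/4
    ([excess_refinement]).  These sets cover: in the support of a nearby
    point of the simplex, choose an index where [f x] is largest.  They are
    locally finite: the condition forces the [k]-th coordinate above a height which
    is locally bounded away from 0, which only finitely many coordinates exceed.

    The density of [E] is at most the cardinality of [K] because there are no more
    finite words over the infinite set [K] than elements of [K] ([card_seq_le]), and
    rational combinations of the unit vectors are dense ([density_le_generated]). *)

Local Open Scope classical_set_scope.
Local Open Scope card_scope.

(** * Finite words over an infinite set *)

Lemma card_le_injP (T U : Type) (A : set T) (B : set U) (u0 : U) :
  A #<= B <-> exists2 f : T -> U, set_fun A B f & set_inj A f.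
Proof.
split=> [/card_leP[i]|/injfunPex[f]]; last exact: inj_card_le.
pose f t := if pselect (A t) is left At then val (i (SigSub (mem_set At))) else u0.
exists f => [t At|t t' /set_mem At /set_mem At'] /=; rewrite /f; case: pselect => // At1.
  exact/set_mem/valP.
case: pselect => // At2 /val_inj /inj; rewrite !inE => /(_ I I) /(congr1 val).
by [].
Qed.

Section words.
Variable K : choiceType.
Implicit Types (G : set (seq K * K)) (A : set K) (s t : seq K).

(** The letters are read off the one-letter words, so that a set of pairs is a
    complete description of a coding and set inclusion means extension, as
    Zorn's lemma for unions of chains requires. *)
Definition alphabet G : set K := [set a | exists x, G ([:: a], x)].

(** [G] is the graph of an injection of all the words over its alphabet into
    that same alphabet. *)
Definition word_coding G :=
  [/\ forall s x y, G (s, x) -> G (s, y) -> x = y,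
      forall s t x, G (s, x) -> G (t, x) -> s = t,
      forall s, (exists x, G (s, x)) <-> {in s, forall a, alphabet G a} &
      forall s x, G (s, x) -> alphabet G x].

(** The countable case starts Zorn's lemma: words over [nat] are countable. *)
Lemma word_coding_nat : infinite_set [set: K] ->
  exists2 G, G !=set0 & word_coding G.
Proof.
move=> Kinf; have [k0 _] := infinite_setN0 Kinf.
move/infiniteP: Kinf => /(card_le_injP _ _ k0)[i _ iinjT].
have iinj : injective i by move=> m n; apply: iinjT; rewrite inE.
have Ga m : exists x, exists2 u : seq nat, [:: i m] = map i u & x = i (pickle u).
  by exists (i (pickle [:: m])), [:: m].
exists [set p | exists2 u : seq nat, p.1 = map i u & p.2 = i (pickle u)].
  by exists ([::], i (pickle ([::] : seq nat))), [::].
split=> /=.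
- by move=> s x y [u -> ->] [v /(inj_map iinj) -> ->].
- by move=> s t x [u -> ->] [v -> /iinj /(pcan_inj pickleK) ->].
- move=> s; split=> [[x [u -> _]] _ /mapP[m _ ->]|]; first exact: Ga.
  move=> sG; suff [u ->] : exists u, s = map i u by exists (i (pickle u)), u.
  elim: s sG => [_|a s IHs sG]; first by exists [::].
  have [|u ->] := IHs; first by move=> b bs; apply: sG; rewrite inE bs orbT.
  have [_ [[|m v] //= [-> _] _]] := sG a (mem_head _ _).
  by exists (m :: u).
- by move=> s x [u _ ->]; exact: Ga.
Qed.

(** A word has finitely many letters, so a word over the union of a chain is
    already a word over the alphabet of one member of the chain. *)
Lemma word_coding_bigcup (F : set (set (seq K * K))) :
  F !=set0 -> F `<=` word_coding -> total_on F subset ->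
  word_coding (\bigcup_(G in F) G).
Proof.
move=> [G0 FG0] FP Ftot.
have common p q : (\bigcup_(G in F) G) p -> (\bigcup_(G in F) G) q ->
    exists G, [/\ F G, G p & G q].
  move=> [G FG Gp] [H FH Hq].
  by have [GH|HG] := Ftot _ _ FG FH;
    [exists H; split=> //; exact: GH|exists G; split=> //; exact: HG].
have alpha G a : F G -> alphabet G a -> alphabet (\bigcup_(G in F) G) a.
  by move=> FG [x Gx]; exists x, G.
split.
- move=> s x y Gx /(common _ _ Gx)[G [/FP[G1 _ _ _] Gsx Gsy]].
  exact: G1 Gsx Gsy.
- move=> s t x Gx /(common _ _ Gx)[G [/FP[_ G2 _ _] Gsx Gsy]].
  exact: G2 Gsx Gsy.
- move=> s; split=> [[x [G FG Gsx]] a as_|sF].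
    have [_ _ /(_ s)[G3 _] _] := FP _ FG.
    by apply: (alpha _ _ FG); apply: G3 as_; exists x.
  suff [G FG sG] : exists2 G, F G & {in s, forall a, alphabet G a}.
    have [_ _ /(_ s)[_ /(_ sG)[x Gsx]] _] := FP _ FG.
    by exists x, G.
  elim: s sF => [_|a s IHs sF]; first by exists G0.
  have [|G FG sG] := IHs; first by move=> b bs; apply: sF; rewrite inE bs orbT.
  have [x [H FH Hx]] := sF a (mem_head _ _).
  have [GH|HG] := Ftot _ _ FG FH.
    exists H => // b; rewrite inE => /predU1P[->|/sG[y Gy]]; first by exists x.
    by exists y; exact: GH.
  exists G => // b; rewrite inE => /predU1P[->|/sG//].
  by exists x; exact: HG.
- move=> s x [G FG Gsx]; have [_ _ _ G4] := FP _ FG.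
  by apply: (alpha _ _ FG); exact: G4 Gsx.
Qed.

Lemma word_codingP G : word_coding G -> exists g : seq K -> K, forall s,
  {in s, forall a, alphabet G a} -> G (s, g s).
Proof.
move=> [_ _ G3 _].
suff /boolp.choice[g gP] : forall s, exists x,
  {in s, forall a, alphabet G a} -> G (s, x) by exists g.
move=> s.
have [/G3[x Gx]|nG] := pselect {in s, forall a, alphabet G a}; first by exists x.
have [x _] : exists x, G ([::], x) by apply/G3.
by exists x => /nG.
Qed.

Lemma set_inj_map (T U : eqType) (A : set T) (j : T -> U) :
  set_inj A j ->
  {in [set s | {in s, forall a, A a}] &, injective (map j)}.
Proof.
move=> ji s t /set_mem/= sA /set_mem/=.
elim: s t sA => [|a s IHs] [|b t] //= sA tA [].
move=> /ji -> ; rewrite ?inE.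
- by move=> /IHs -> // c cs; [apply: sA|apply: tA]; rewrite inE cs orbT.
- exact/sA/mem_head.
- exact/tA/mem_head.
Qed.

(** Let [A] be the alphabet of a maximal coding [g].  Two copies of [A] inject
    into [A] by sending a letter [a] of the first copy to [g [:: a]] and the
    letter of the second copy that corresponds to [b] to [g [:: b; b]].  If [A]
    injects into its complement, this doubling injects the words over the union
    of [A] and a disjoint copy [B] of [A] into [A], hence also into [B], and the
    coding extends to the larger alphabet, which contradicts maximality.  Otherwise the complement of [A] injects into [A], so the same
    doubling injects the whole type into [A], and hence its words as well. *)
Lemma word_coding_max G : G !=set0 -> word_coding G ->
  (forall H, G `<` H -> ~ word_coding H) ->
  exists g : seq K -> K, injective g.
Proof.
move=> G0 GP Gmax; have [g gP] := word_codingP GP.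
have [G1 G2 G3 G4] := GP.
pose A := alphabet G.
have gA s : {in s, forall a, A a} -> A (g s).
  by move=> sA; apply: (G4 s); exact: gP.
have gi s t : {in s, forall a, A a} -> {in t, forall a, A a} -> g s = g t -> s = t.
  by move=> /gP Gs /gP Gt gst; apply: (G2 s t (g t)) => //; rewrite -gst.
have A1 a : A a -> {in [:: a], forall b, A b} by move=> Aa b; rewrite inE => /eqP->.
have A2 a : A a -> {in [:: a; a], forall b, A b}.
  by move=> Aa b; rewrite !inE => /orP[] /eqP->.
have double (C : set K) (h : K -> K) : (forall c, C c -> ~ A c -> A (h c)) ->
    set_inj (C `\` A) h ->
    exists j : K -> K, set_fun C A j /\ set_inj C j.
  move=> hA hi; exists (fun c => if pselect (A c) then g [:: c] else g [:: h c; h c]).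
  split=> [c Cc|c d /set_mem Cc /set_mem Cd] /=.
    by case: pselect => Ac; apply: gA; [exact: A1|apply/A2/hA].
  case: pselect => Ac; case: pselect => Ad.
  - by move/(gi _ _ (A1 _ Ac) (A1 _ Ad)) => -[].
  - by move/(gi _ _ (A1 _ Ac) (A2 _ (hA _ Cd Ad))).
  - by move/(gi _ _ (A2 _ (hA _ Cc Ac)) (A1 _ Ad)).
  - move/(gi _ _ (A2 _ (hA _ Cc Ac)) (A2 _ (hA _ Cd Ad))) => -[hcd].
    by apply: hi; rewrite ?inE.
have a0 : A (g [::]) by apply: gA.
(* The less numerous of [A] and its complement injects into the other. *)
have [_ [->|->] Cmin] := @least_card_ex K [set A; ~` A] (ex_intro _ A (or_introl erefl)).
- have /(card_le_injP _ _ (g [::]))[h hB hi] : A #<= ~` A by apply: Cmin; right.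
  exfalso.
  pose B := h @` A.
  have BA b : B b -> ~ A b by move=> [a Aa <-]; exact: hB.
  have [h' h'A h'i] : exists2 h' : K -> K, set_fun B A h' & set_inj B h'.
    apply/(card_le_injP _ _ (g [::])); exact: card_image_le.
  have [j [jA ji]] : exists j : K -> K, set_fun (A `|` B) A j /\ set_inj (A `|` B) j.
    apply: (double _ h').
      by move=> c [|/h'A].
    by move=> c d /set_mem[[|Bc] nAc] // /set_mem[[|Bd] nAd] //; apply: h'i; rewrite inE.
  pose C := A `|` B.
  (* A word over [A] keeps its code in [A]; any other word is given a code in
     [B], so that old and new codes cannot collide. *)
  pose New := [set p : seq K * K | [/\ {in p.1, forall a, C a},
     ~ {in p.1, forall a, A a} & p.2 = h (g (map j p.1))]].
  have NewB s x : New (s, x) -> B x.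
    move=> [/= sC _ ->]; exists (g (map j s)) => //.
    by apply: gA => _ /mapP[a /sC Ca ->]; exact: jA.
  have GA s x : G (s, x) -> {in s, forall a, A a} by move=> Gsx; apply/G3; exists x.
  have NewC s : {in s, forall a, C a} -> exists x, (G `|` New) (s, x).
    move=> sC; have [sA|nsA] := pselect {in s, forall a, A a}.
      by exists (g s); left; exact: gP.
    by exists (h (g (map j s))); right.
  have alphaC : alphabet (G `|` New) = C.
    apply/seteqP; split=> [a [x [Gx|[/= + _ _]]]|a Ca].
    - by left; exists x.
    - by apply; exact: mem_head.
    - by apply: NewC => b; rewrite inE => /eqP->.
  apply: (Gmax (G `|` New)).
    split; first by left.
    move=> /(_ ([:: h (g [::])], h (g (map j [:: h (g [::])])))) H.
    suff : G ([:: h (g [::])], h (g (map j [:: h (g [::])]))).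
      move=> /G4; apply: hB; apply: gA => _ /mapP[b + ->].
      by rewrite inE => /eqP->; apply: jA; right; exists (g [::]).
    apply: H; right; split=> [b /=|/= sA|//].
      by rewrite inE => /eqP->; right; exists (g [::]).
    by apply: (hB _ a0); apply: sA; exact: mem_head.
  split.
  - move=> s x y [Gx|Nx] [Gy|Ny]; first exact: G1 Gx Gy.
    + by case: Ny => /= _ []; exact: GA Gx.
    + by case: Nx => /= _ []; exact: GA Gy.
    + by case: Nx => /= _ _ ->; case: Ny.
  - move=> s t x [Gx|Nx] [Gy|Ny]; first exact: G2 Gx Gy.
    + by case: (BA x); [exact: NewB Ny|exact: G4 Gx].
    + by case: (BA x); [exact: NewB Nx|exact: G4 Gy].
    + case: Nx Ny => /= sC _ -> [/= tC _ hst].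
      have sgA u : {in u, forall a, C a} -> {in map j u, forall a, A a}.
        by move=> uC _ /mapP[a /uC Ca ->]; exact: jA.
      apply: (set_inj_map ji); rewrite ?inE//.
      apply: gi; [exact: sgA|exact: sgA|].
      by apply: hi => //; rewrite inE; apply/gA/sgA.
  - move=> s; rewrite alphaC; split=> [[x [Gx a /(GA _ _ Gx)|[] //]]|/NewC //].
    by left.
  - move=> s x; rewrite alphaC => -[/G4|/NewB]; [by left|by right].
- have /(card_le_injP _ _ (g [::]))[h hA hi] : ~` A #<= A by apply: Cmin; left.
  have [|//|j [jA ji]] := @double [set: K] h.
    by move=> c _; exact: hA.
  by rewrite setTD.
  have jT s : {in map j s, forall a, A a} by move=> _ /mapP[a _ ->]; exact: jA.
  exists (g \o map j) => s t /= /(gi _ _ (jT _) (jT _)).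
  by apply: (inj_map (fun a b => ji a b (mem_set I) (mem_set I))).
Qed.

End words.

(** The empty chain has an empty union, which codes no word (not even the empty
    one); hence the disjunct [G = set0], which the countable coding shows not
    to be maximal. *)
Lemma card_seq_le (K : Type) : infinite_set [set: K] ->
  [set: seq K] #<= [set: K].
Proof.
move=> Kinf; have [k0 _] := infinite_setN0 Kinf.
have Kinf' : infinite_set [set: {classic K}] by [].
have [G0 G0n G0P] := word_coding_nat Kinf'.
have [|G [GP Gmax]] := @Zorn_bigcup (seq {classic K} * {classic K})
    [set G | G = set0 \/ word_coding G].
  move=> F FP Ftot.
  have [[G [FG Gn]]|nF] := pselect (exists G, F G /\ G !=set0); last first.
    left; rewrite -subset0 => p [G FG Gp]; apply: nF; exists G; split=> //.
    by exists p.
  right.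
  have -> : \bigcup_(G in F) G = \bigcup_(G in F `&` [set G | G !=set0]) G.
    apply/seteqP; split=> p [H].
      by move=> FH Hp; exists H => //; split=> //; exists p.
    by move=> [FH _] Hp; exists H.
  apply: word_coding_bigcup; first by exists G.
    by move=> H [/FP[-> [p]|//]].
  by move=> H H' [FH _] [FH' _]; exact: Ftot.
have Gn : G !=set0.
  apply: contrapT => /set0P/negP/negPn/eqP GE.
  apply: (Gmax G0); last by right.
  by rewrite GE properEneq eq_sym; split=> //; apply/set0P.
have {}GP : word_coding G by case: GP => // GE; case: Gn; rewrite GE.
have [|g gi] := word_coding_max Gn GP.
  by move=> H GH HP; apply: (Gmax H) => //; right.
by apply/(card_le_injP _ _ k0); exists g => // s t _ _ /gi.
Qed.

Local Open Scope ring_scope.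

(** * Density of a topological vector space spanned by a family *)

(** The combinations with rational coefficients are dense because the closure of
    the set that they form absorbs [r *: e k + _] for every real [r], addition
    and scaling being continuous.  They are indexed by the words over [K * K],
    [q] reading a rational off an element of [K], and there are no more such
    words than elements of [K]. *)
Lemma density_le_generated (R : realType) (E : topologicalLmodType R)
    (K : Type) (e : K -> E) : infinite_set [set: K] ->
  (forall y : E, exists s : seq (R * K), y = \sum_(p <- s) p.1 *: e p.2) ->
  density_le E K.
Proof.
move=> Kinf gen; have [k0 _] := infinite_setN0 Kinf.
have /(card_le_injP _ _ k0)[i _ ii] : [set: rat] #<= [set: K].
  move/infiniteP: Kinf; apply: card_le_trans.
  by rewrite (card_le_eql card_rat); exact: card_lexx.
have /boolp.choice[q qP] : forall k, exists r : rat, forall r', i r' = k -> r' = r.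
  move=> k; have [[r <-]|nk] := pselect (exists r, i r = k).
    by exists r => r' /ii; apply; rewrite inE.
  by exists 0 => r' ir'; case: nk; exists r'.
have {ii}qi r : q (i r) = r by rewrite -(qP _ _ erefl).
have /(card_le_injP _ _ k0)[c _ ci'] := card_seq_le Kinf.
have ci : injective c by move=> s t /ci'; apply; rewrite inE.
pose comb (s : seq (K * K)) : E := \sum_(p <- s) ratr (q p.1) *: e p.2.
apply/density_leP; exists (range comb); last first.
  apply: card_le_trans (card_image_le _ _) _.
  apply/(card_le_injP _ _ k0); exists (fun s => c [seq c [:: p.1; p.2] | p <- s]) => //.
  by move=> s t _ _ /ci; apply: inj_map => -[a b] [a' b'] /ci [-> ->].
suff cl s : closure (range comb) (\sum_(p <- s) p.1 *: e p.2 : E).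
  move=> O [y Oy] oO; have [s yE] := gen y.
  have := cl s; rewrite -yE => /(_ O (open_nbhs_nbhs (conj oO Oy))).
  by rewrite setIC.
elim: s => [|[r k] s IHs].
  by apply: subset_closure; exists [::]; rewrite // /comb !big_nil.
move=> O; rewrite big_cons /=.
have cont : continuous (fun z : R^o * E => z.1 *: e k + z.2).
  move=> z; apply: (@continuous_comp _ (E * E)%type _
    (fun z : R^o * E => (z.1 *: e k, z.2)) (fun w => w.1 + w.2)); last first.
    exact: add_continuous.
  apply: (@cvg_pair _ _ _ _ (nbhs (z.1 *: e k)) (nbhs z.2)); last exact: cvg_snd.
  apply: (@continuous_comp _ (R^o * E)%type _
    (fun z : R^o * E => (z.1, e k)) (fun w => w.1 *: w.2)); last first.
    exact: scale_continuous.
  apply: (@cvg_pair _ _ _ _ (nbhs (z.1 : R^o)) (nbhs (e k))); [exact: cvg_fst|exact: cvg_cst].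
move=> /(cont (r, \sum_(p <- s) p.1 *: e p.2)) [[A B] /= [Ar Bs] ABO].
have [x []] : (range (@ratr R) `&` A°) !=set0.
  rewrite setIC; apply: dense_rat; last exact: open_interior.
  by exists r; exact: Ar.
move=> [t _ <-] /interior_subset At.
have [_ [[u _ <-] Bu]] := IHs _ Bs.
exists (comb ((i t, k) :: u)); split; first by exists ((i t, k) :: u).
by rewrite /comb big_cons /= qi; exact: (ABO (ratr t, comb u)).
Qed.

(** * Shrinkings and partitions of unity in normal spaces *)

Section shrinking.
Variables (X : topologicalType) (I : Type) (W : I -> set X).
Hypotheses (Xnormal : normal_space X) (Wopen : forall i, open (W i))
  (Wfin : forall x, finite_set [set i | W i x])
  (Wcover : forall x, exists i, W i x).
Implicit Types (S : set (I * set X)).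

Definition shrunk S : set I := [set i | exists O, S (i, O)].

(** A partial function [i |-> O] is encoded by its graph, so that larger sets
    extend the shrinking without changing what is already shrunk.  The [O] with
    [i] shrunk and the [W i] with [i] not shrunk still cover the space. *)
Definition partial_shrinking S :=
  [/\ forall i O O', S (i, O) -> S (i, O') -> O = O',
      forall i O, S (i, O) -> open O /\ closure O `<=` W i &
      forall x, exists i,
        (exists2 O, S (i, O) & O x) \/ (~ shrunk S i /\ W i x)].

(** The covering condition survives because a point lies in finitely many [W i]:
    if all of these are shrunk in the union, they are all shrunk in one member of
    the chain, which covers the point. *)
Lemma partial_shrinking_bigcup (F : set (set (I * set X))) :
  F `<=` partial_shrinking -> total_on F subset ->
  partial_shrinking (\bigcup_(S in F) S).
Proof.
move=> FP Ftot; split.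
- move=> i O O' [S FS SO] [S' FS' SO'].
  have [SS'|S'S] := Ftot _ _ FS FS'.
    by have [fS' _ _] := FP _ FS'; exact: fS' (SS' _ SO) SO'.
  by have [fS _ _] := FP _ FS; exact: fS SO (S'S _ SO').
- by move=> i O [S FS SO]; have [_ + _] := FP _ FS; exact.
- move=> x.
  have [[i [nsi Wix]]|all] :=
      pselect (exists i, ~ shrunk (\bigcup_(S in F) S) i /\ W i x).
    by exists i; right.
  have {}all i : W i x -> exists2 S, F S & shrunk S i.
    move=> Wix; apply: contrapT => nS; apply: all; exists i; split=> //.
    by move=> [O [S FS SO]]; apply: nS; exists S => //; exists O.
  suff [S FS SW] : exists2 S, F S & forall i, W i x -> shrunk S i.
    have [_ Sopen /(_ x)[i [[O SO Ox]|[nsi Wix]]]] := FP _ FS.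
      by exists i; left; exists O => //; exists S.
    by case: nsi; exact: SW.
  have [i0 W0] := Wcover x; have [S0 FS0 _] := all _ W0.
  have /finite_seqP[s sE] : finite_set ([set i | W i x] : set {classic I}).
    exact: Wfin.
  have {}all : forall i : {classic I}, i \in s -> exists2 S, F S & shrunk S i.
    by move=> i is_; apply: all; have : [set` s] i by []; rewrite -sE.
  suff [S FS SW] : exists2 S, F S & forall i : {classic I}, i \in s -> shrunk S i.
    by exists S => // i Wix; apply: SW; have : [set j | W j x] i by []; rewrite sE.
  elim: s {sE} all => [_|i s IHs all]; first by exists S0.
  have [|S FS SW] := IHs; first by move=> j js; apply: all; rewrite inE js orbT.
  have [S' FS' [O S'O]] := all i (mem_head _ _).
  have [SS'|S'S] := Ftot _ _ FS FS'.
    exists S' => // j; rewrite inE => /predU1P[->|/SW[O' SO']]; first by exists O.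
    by exists O'; exact: SS'.
  exists S => // j; rewrite inE => /predU1P[->|/SW//].
  by exists O; exact: S'S.
Qed.

(** The points that the other sets leave uncovered form a closed subset of [W i],
    so normality provides a smaller open set to replace [W i]. *)
Lemma shrunk_max S : partial_shrinking S ->
  (forall S', S `<` S' -> ~ partial_shrinking S') -> forall i, shrunk S i.
Proof.
move=> [Sfun SW Scov] Smax i; apply: contrapT => nSi.
pose cur j := [set x | (exists2 O, S (j, O) & O x) \/ (~ shrunk S j /\ W j x)].
have ocur j : open (cur j).
  have [[O SO]|nsj] := pselect (shrunk S j).
    have -> : cur j = O.
      apply/seteqP; split=> [x [[O' SO' O'x]|[]]|x Ox].
      - by rewrite (Sfun _ _ _ SO SO').
      - by case; exists O.
      - by left; exists O.
    by have [] := SW _ _ SO.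
  have -> : cur j = W j; last exact: Wopen.
  apply/seteqP; split=> [x [[O' SO' O'x]|[]//]|x Wjx]; last by right.
  by case: nsj; exists O'.
pose A := ~` \bigcup_(j in [set~ i]) cur j.
have cA : closed A by apply: open_closedC; apply: bigcup_open => j _; exact: ocur.
have AW : A `<=` W i.
  move=> x Ax; have [j jx] := Scov x.
  have [ij|ij] := pselect (j = i); last by case: Ax; exists j.
  case: jx => [[O SO _]|[]]; last by rewrite ij.
  by case: nSi; exists O; rewrite -ij.
have [V] : filter_from (set_nbhs A) closure (W i).
  by apply: Xnormal => //; apply/set_nbhsP; exists (W i); split.
move=> /set_nbhsP[O [oO AO OV]] VW.
apply: (Smax (S `|` [set (i, O)])).
  split; first by left.
  by move=> /(_ (i, O)) SO; apply: nSi; exists O; apply: SO; right.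
have clO : closure O `<=` W i by apply: subset_trans VW; exact: closureS.
split.
- move=> j O1 O2 [SO1|[-> ->]] [SO2|]; first exact: Sfun SO1 SO2.
  + by move=> [ji _]; case: nSi; exists O1; rewrite -ji.
  + by case: nSi; exists O2.
  + by case.
- by move=> j O1 [/SW//|[-> ->]].
- move=> x; have [[j ij jx]|Ax] := pselect ((\bigcup_(j in [set~ i]) cur j) x).
    exists j; case: jx => [[O' SO' O'x]|[nsj Wjx]].
      by left; exists O' => //; left.
    right; split=> // -[O' [SO'|[ji _]]]; last exact: ij.
    by apply: nsj; exists O'.
  by exists i; left; exists O; [right|exact: AO].
Qed.

Lemma shrinking : exists C : I -> set X,
  [/\ forall i, closed (C i), forall i, C i `<=` W i & forall x, exists i, C i x].
Proof.
have [S [SP Smax]] := Zorn_bigcup partial_shrinking_bigcup.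
have all := shrunk_max SP Smax; have [Sfun SW Scov] := SP.
have /boolp.choice[C CP] := all.
exists (closure \o C); split=> [i|i|x]; first exact: closed_closure.
  by have [] := SW _ _ (CP i).
have [i [[O SO Ox]|[]//]] := Scov x.
by exists i; apply: subset_closure; rewrite (Sfun _ _ _ (CP i) SO).
Qed.

(** Urysohn functions that are 1 on a closed shrinking.  They form a partition of
    unity up to division by their sum. *)
Lemma partition_weights (R : realType) : exists w : I -> X -> R,
  [/\ forall i, continuous (w i : X -> R^o), forall i x, 0 <= w i x,
      forall i x, w i x != 0 -> W i x & forall x, exists i, w i x != 0].
Proof.
have [C [cC CW Ccov]] := shrinking.
suff /boolp.choice[w wP] : forall i, exists w : X -> R, [/\ continuous (w : X -> R^o),
    forall x, 0 <= w x, forall x, w x != 0 -> W i x & forall x, C i x -> w x = 1].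
  exists w; split=> [i|i|i|x]; try by have [] := wP i.
  have [i Cix] := Ccov x; exists i; have [_ _ _ w1] := wP i.
  by rewrite w1// oner_eq0.
move=> i.
have /(@uniform_separatorP _ R)[w [cw w01 w0 w1]] : uniform_separator (~` W i) (C i).
  apply: (proj1 (@normal_separatorP R X)) => //; first exact: open_closedC.
  by rewrite setIC; apply/disjoints_subset; rewrite setCK.
exists w; split=> // [x|x wx0|x Cix].
- have /w01 : range w (w x) by exists x.
  by rewrite /= in_itv /= => /andP[].
- apply: contrapT => nWx; have := w0 (w x); move/eqP: wx0 => + h; apply.
  by apply: h; exists x.
- by apply: (w1 (w x)); exists x.
Qed.

End shrinking.

(** * Locally finite sums and convex combinations *)

Section locally_finite_sums.
Variables (R : realType) (X : topologicalType) (E : topologicalLmodType R).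

Lemma fsum_seq (I : choiceType) (M : nmodType) (r : seq I) (F : I -> M) :
  uniq r -> (forall i, i \notin r -> F i = 0) ->
  \sum_(i \in [set: I]) F i = \sum_(i <- r) F i.
Proof.
move=> ur F0; rewrite (fsbigE r)//; last by move=> i _; exact: F0.
by apply: eq_bigl => i; rewrite in_setT.
Qed.

Lemma continuous_sum (I : Type) (r : seq I) (F : I -> X -> E) :
  (forall i, continuous (F i)) -> continuous (fun x => \sum_(i <- r) F i x).
Proof.
move=> cF; elim: r => [|i r IHr] x.
  under eq_fun do rewrite big_nil; exact: cvg_cst.
rewrite (_ : (fun _ => _) = fun x => F i x + \sum_(j <- r) F j x); last first.
  by apply/funext => y; rewrite big_cons.
apply: (@continuous_comp _ (E * E)%type _
    (fun z => (F i z, \sum_(j <- r) F j z)) (fun w => w.1 + w.2)); last first.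
  exact: add_continuous.
apply: (@cvg_pair _ _ _ _ (nbhs (F i x)) (nbhs (\sum_(j <- r) F j x))).
  exact: cF.
exact: IHr.
Qed.

(** Near each point the sum is a sum over a fixed finite set of indices. *)
Lemma continuous_fsum (I : choiceType) (F : I -> X -> E) :
  (forall i, continuous (F i)) ->
  (forall x : X, exists2 N : set X, nbhs x N &
     finite_set [set i | exists2 y, N y & F i y != 0]) ->
  continuous (fun x => \sum_(i \in [set: I]) F i x).
Proof.
move=> cF locF x; have [N Nx fN] := locF x.
pose r : seq I := fset_set [set i | exists2 y, N y & F i y != 0].
have sumE y : N y -> \sum_(i \in [set: I]) F i y = \sum_(i <- r) F i y.
  move=> Ny; apply: fsum_seq; first exact: fset_uniq.
  move=> i; rewrite in_fset_set// notin_setE /= => nF.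
  by apply: contrapT => /eqP F0; apply: nF; exists y.
move=> O; rewrite /= sumE; last exact: nbhs_singleton.
move=> /(@continuous_sum I r F cF x) /= rO.
by apply: filterS (filterI Nx rO) => y [/sumE /= -> Oy].
Qed.

End locally_finite_sums.

(** The weights are normalized in the conclusion rather than summing to 1, which
    lets the induction on [r] drop an element. *)
Lemma convex_combination (R : realType) (E : lmodType R)
    (A : set (convex_lmodType E)) (I : Type) (r : seq I) (w : I -> R) (a : I -> E) :
  convex_set A -> (forall i, 0 <= w i) -> (forall i, w i != 0 -> A (a i)) ->
  0 < \sum_(i <- r) w i ->
  A ((\sum_(i <- r) w i)^-1 *: \sum_(i <- r) w i *: a i).
Proof.
move=> cA w0 wA.
pose S r := \sum_(i <- r) w i; pose V r := \sum_(i <- r) w i *: a i.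
have [[S0 _]|[_ AV _]] : (S r = 0 /\ V r = 0) \/ (0 < S r /\ A ((S r)^-1 *: V r));
  rewrite -?/(S r) -?/(V r) ?S0 ?ltxx//.
elim: r => [|i r IHr]; first by left; rewrite /S /V !big_nil.
rewrite /S /V !big_cons -/(S r) -/(V r).
have [->|wi] := eqVneq (w i) 0; first by rewrite scale0r !add0r.
have wi0 : 0 < w i by rewrite lt_neqAle eq_sym wi w0.
right; case: IHr => [[-> ->]|[S0 AV]].
  by rewrite !addr0 scalerA mulVf// scale1r; split=> //; exact: wA.
have T0 : 0 < w i + S r by exact: addr_gt0.
split=> //.
have l01 : 0 <= w i / (w i + S r) <= 1.
  by rewrite divr_ge0 ?(ltW T0)//= ler_pdivrMr// mul1r lerDl ltW.
have := cA (a i) ((S r)^-1 *: V r) (Itv01 (andP l01).1 (andP l01).2).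
rewrite !inE => /(_ (wA _ wi) AV).
congr A; rewrite /conv /= scalerDr !scalerA; congr (_ *: _ + _ *: _).
  by rewrite mulrC.
transitivity ((1 - w i / (w i + S r)) * (S r)^-1) => //.
rewrite -[1](mulfV (lt0r_neq0 T0)) -mulrBl addrAC subrr add0r.
by rewrite mulrAC mulfV ?mul1r// lt0r_neq0.
Qed.

(** * Selections from locally finite covers *)

Lemma open_ysection (X Y : topologicalType) (Phi : set (X * Y)) (y : Y) :
  open Phi -> open (ysection Phi y).
Proof.
move=> oPhi; rewrite (_ : ysection Phi y = (fun x => (x, y)) @^-1` Phi).
  apply: (@open_comp _ _ (fun x => (x, y)) Phi) => // x _.
  by apply: (@cvg_pair _ _ _ _ (nbhs x) (nbhs y)); [exact: cvg_id|exact: cvg_cst].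
by apply/seteqP; split=> x /ysectionP.
Qed.

Lemma open_xsection (X Y : topologicalType) (Phi : set (X * Y)) (x : X) :
  open Phi -> open (xsection Phi x).
Proof.
move=> oPhi; rewrite (_ : xsection Phi x = (fun y => (x, y)) @^-1` Phi).
  apply: (@open_comp _ _ (fun y => (x, y)) Phi) => // y _.
  by apply: (@cvg_pair _ _ _ _ (nbhs x) (nbhs y)); [exact: cvg_cst|exact: cvg_id].
by apply/seteqP; split=> y /xsectionP.
Qed.

Section selections.
Variables (R : realType) (X : topologicalType) (E : topologicalLmodType R).
Variables (Phi : set (X * E)).
Hypotheses (Phi_convex : convex_valued Phi).

(** With [W d] inside the set of points [x] such that [d] is in [Phi x], the
    weighted average of the [d] is at each [x] a convex combination of points of
    [Phi x]. *)
Lemma selection_of_locally_finite (W : E -> set X) :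
  normal_space X -> (forall d, open (W d)) -> (forall x, exists d, W d x) ->
  (forall x : X, exists2 N : set X, nbhs x N &
     finite_set [set d | W d `&` N !=set0]) ->
  (forall d x, W d x -> Phi (x, d)) ->
  exists2 f : X -> E, continuous f & selection Phi f.
Proof.
move=> Xnormal oW Wcov Wfin WPhi.
have Wpt x : finite_set [set d | W d x].
  have [N Nx fN] := Wfin x; apply: sub_finite_set fN => d Wdx; exists x.
  by split=> //; exact: nbhs_singleton.
have [w [cw w0 wW wcov]] := partition_weights Xnormal oW Wpt Wcov R.
pose S x : R^o := \sum_(d \in [set: E]) (w d x : R^o).
pose V x : E := \sum_(d \in [set: E]) w d x *: d.
have cS : continuous S.
  apply: (@continuous_fsum R X R^o E) => // x; have [N Nx fN] := Wfin x.
  exists N => //; apply: sub_finite_set fN => d [y Ny wdy].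
  by exists y; split=> //; exact: wW.
have cV : continuous V.
  apply: (@continuous_fsum R X E E) => [d x|x].
    apply: (@continuous_comp _ (R^o * E)%type _
      (fun z => (w d z, d)) (fun z : R^o * E => z.1 *: z.2)).
      apply: (@cvg_pair _ _ _ _ (nbhs (w d x : R^o)) (nbhs d)); [exact: cw|exact: cvg_cst].
    exact: scale_continuous.
  have [N Nx fN] := Wfin x; exists N => //; apply: sub_finite_set fN => d [y Ny].
  rewrite scaler_eq0 => /norP[wdy _].
  by exists y; split=> //; exact: wW.
have sums x : exists r : seq E, [/\ S x = \sum_(d <- r) w d x,
    V x = \sum_(d <- r) w d x *: d & 0 < S x].
  pose r : seq E := fset_set [set d | W d x].
  have r0 d : d \notin r -> w d x = 0.
    rewrite in_fset_set// notin_setE /= => nW.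
    by apply: contrapT => /eqP /wW.
  have Sr : S x = \sum_(d <- r) w d x by apply: fsum_seq => //; exact: fset_uniq.
  exists r; split=> //.
    by apply: fsum_seq; [exact: fset_uniq|move=> d /r0 ->; rewrite scale0r].
  rewrite lt_neqAle eq_sym Sr sumr_ge0 ?andbT; last by move=> d _; exact: w0.
  have [d wd] := wcov x.
  rewrite (big_rem d)/=; last by apply: contraNT wd => /r0 ->.
  rewrite paddr_eq0// ?negb_and ?wd//.
  by rewrite sumr_ge0.
exists (fun x => (S x)^-1 *: V x) => x.
  apply: (@continuous_comp _ (R^o * E)%type _
    (fun z => ((S z)^-1 : R^o, V z)) (fun z : R^o * E => z.1 *: z.2)); last first.
    exact: scale_continuous.
  apply: (@cvg_pair _ _ _ _ (nbhs ((S x)^-1 : R^o)) (nbhs (V x))); last exact: cV.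
  apply: cvgV; last exact: cS.
  by have [r [_ _ /lt0r_neq0]] := sums x.
have [r [Sr Vr S0]] := sums x; rewrite Sr Vr.
apply: (@convex_combination _ _ _ _ r (fun d => w d x) id).
- exact: Phi_convex.
- by move=> d; exact: w0.
- by move=> d /wW /WPhi Phixd; apply/mem_set.
- by rewrite -Sr.
Qed.

(** The values of [Phi] are nonempty and open, so they meet a dense set [D]: the
    open sets of points [x] with [d] in [Phi x], for [d] in [D], cover [X]. *)
Lemma selection_of_paracompact (K : Type) :
  tau_paracompact K X -> normal_space X -> density_le E K ->
  set_valued Phi -> open Phi ->
  exists2 f : X -> E, continuous f & selection Phi f.
Proof.
move=> Xpara Xnormal [D [dD _] DK] Phi_val oPhi.
pose U d := ysection Phi d.
have [||V [[oV Vcov] VU Vfin]] := Xpara (U @` D).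
  split=> [_ [d _ <-]|]; first exact: open_ysection.
  apply/seteqP; split=> // x _.
  have [|d [Phixd Dd]] := dD (xsection Phi x) (Phi_val x).
    exact: open_xsection.
  by exists (U d); [exists d|apply/ysectionP/xsectionP].
  exact: card_le_trans (card_image_le _ _) DK.
have /boolp.choice[c cP] : forall B, exists d, V B -> B `<=` U d.
  move=> B; have [/VU[_ [d _ <-] BU]|nVB] := pselect (V B); first by exists d.
  by exists 0.
(* The refinement is regrouped by the index of a set that contains its member. *)
apply: (@selection_of_locally_finite (fun d => \bigcup_(B in V `&` [set B | c B = d]) B)).
- exact: Xnormal.
- by move=> d; apply: bigcup_open => B [/oV].
- move=> x; have [B VB Bx] : cover V id x by rewrite Vcov.
  by exists (c B), B.
- move=> x; have [N Nx fN] := Vfin x; exists N => //.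
  apply: sub_finite_set (finite_image c fN) => d [y [[B [VB <-] By] Ny]].
  by exists B => //; split=> //; exists y.
- by move=> d x [B [VB <-] Bx]; apply/ysectionP; exact: cP Bx.
Qed.

End selections.

(** * Normality from selections *)

Definition selection_property (R : realType) (K : Type) (X : topologicalType)
    (E : topologicalLmodType R) :=
  hausdorff_space E -> density_le E K ->
  forall Phi : set (X * E),
    set_valued Phi -> convex_valued Phi -> open Phi ->
    exists2 f : X -> E, continuous f & selection Phi f.

Lemma convex_lt (R : realType) (a b c l : R) :
  0 <= l <= 1 -> a < c -> b < c -> l * a + (1 - l) * b < c.
Proof.
move=> /andP[l0 l1] ac bc.
have [->|ln] := eqVneq l 0; first by rewrite mul0r add0r subr0 mul1r.
have {ln} l0' : 0 < l by rewrite lt_neqAle eq_sym ln.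
rewrite [ltRHS](_ : c = l * c + (1 - l) * c); last first.
  by rewrite -mulrDl addrC subrK mul1r.
by rewrite ltr_leD// ?ltr_pM2l// ler_wpM2l ?subr_ge0// ltW.
Qed.

(** A selection of the relation whose value is the half-line below 0 on [A], the
    half-line above 1 on [B] and the whole line elsewhere separates [A] and [B]. *)
Lemma normal_of_selection (R : realType) (K : Type) (X : topologicalType) :
  infinite_set [set: K] -> selection_property K X R^o -> normal_space X.
Proof.
move=> Kinf sel; have [k0 _] := infinite_setN0 Kinf.
have dR : density_le R^o K.
  apply: (density_le_generated (e := fun=> 1 : R^o)) => // y.
  by exists [:: (y, k0)]; rewrite big_seq1 /= /GRing.scale /= mulr1.
apply/(@normal_openP R) => A B cA cB AB0.
pose Phi : set (X * R^o) := [set p | (A p.1 -> p.2 < 0) /\ (B p.1 -> 1 < p.2)].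
have [x|||f cf fPhi] := sel (@norm_hausdorff _ _) dR Phi.
- have [Ax|nAx] := pselect (A x).
    exists (-1); apply/mem_set; split=> /= [_|Bx]; first by rewrite ltrN10.
    by have : (A `&` B) x by []; rewrite AB0.
  by exists 2; apply/mem_set; split=> //= _; rewrite ltr1n.
- move=> x a b l /set_mem/set_mem[/= Aa Ba] /set_mem/set_mem[/= Ab Bb].
  have l01 : 0 <= l%:num <= 1 by rewrite ge0 le1.
  apply/mem_set/mem_set; split=> /= [/[dup]/Aa a0 /Ab b0|/[dup]/Ba a0 /Bb b0].
    exact: convex_lt.
  have := @convex_lt R (- a) (- b) (- 1) _ l01.
  rewrite !ltrN2 => /(_ a0 b0).
  by rewrite !mulrN -opprD ltrN2.
- rewrite (_ : Phi = (fst @^-1` (~` A) `|` snd @^-1` [set t : R^o | t < 0]) `&`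
      (fst @^-1` (~` B) `|` snd @^-1` [set t : R^o | 1 < t])).
    apply: openI; apply: openU; apply: open_comp.
    + by move=> *; exact: cvg_fst.
    + exact: closed_openC.
    + by move=> *; exact: cvg_snd.
    + exact: open_lt.
    + by move=> *; exact: cvg_fst.
    + exact: closed_openC.
    + by move=> *; exact: cvg_snd.
    + exact: open_gt.
  apply/seteqP; split=> [[x t] [/= h1 h2]|[x t] [/= h1 h2]].
    split=> /=.
      by have [/h1|] := pselect (A x); [right|left].
    by have [/h2|] := pselect (B x); [right|left].
  by split=> /= ?; [case: h1|case: h2].
exists (f @^-1` [set t : R^o | t < 0]), (f @^-1` [set t : R^o | 1 < t]); split.
- by apply: open_comp; [move=> *; exact: cf|exact: open_lt].
- by apply: open_comp; [move=> *; exact: cf|exact: open_gt].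
- by move=> x Ax; have /set_mem[/= + _] := fPhi x; exact.
- by move=> x Bx; have /set_mem[/= _ +] := fPhi x; exact.
- rewrite -subset0 => x [/= fx0 fx1].
  by have := lt_trans fx0 (lt_trans ltr01 fx1); rewrite ltxx.
Qed.

(** * Finitely supported functions with the l1 norm *)

Section finsupp.
Variables (R : realType) (K : choiceType).

Definition finsupp_pred : {pred K -> R^o} :=
  fun f => `[< finite_set [set k | f k != 0] >].

Lemma finsupp_submod_closed : submod_closed finsupp_pred.
Proof.
split=> [|a f g /asboolP ff /asboolP fg]; apply/asboolP.
  by rewrite (_ : [set _ | _] = set0)// -subset0 => k /=; rewrite eqxx.
have fU : finite_set ([set k | f k != 0] `|` [set k | g k != 0]).
  by rewrite finite_setU.
apply: sub_finite_set fU => k /=; rewrite -[X in X k]/(a *: f + g).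
have [fk|fk] := eqVneq (f k) 0; last by left.
have [gk|gk] := eqVneq (g k) 0; last by right.
have -> : (a *: f + g) k = a * f k + g k by [].
by rewrite fk gk mulr0 addr0 eqxx.
Qed.

HB.instance Definition _ := GRing.isSubmodClosed.Build R (K -> R^o) finsupp_pred
  finsupp_submod_closed.

Record finsupp := Finsupp {
  finsupp_fun :> K -> R^o ; finsuppP : finsupp_fun \in finsupp_pred }.

HB.instance Definition _ := [isSub for finsupp_fun].
HB.instance Definition _ := [Choice of finsupp by <:].
HB.instance Definition _ := [SubChoice_isSubLmodule of finsupp by <:].

Implicit Types f g z : finsupp.

Definition supported_by (r : seq K) f := forall k, k \notin r -> f k = 0.

Lemma finsupp_support f : exists2 r, uniq r & supported_by r f.
Proof.
have /asboolP fin := finsuppP f.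
exists (fset_set [set k | f k != 0]); first exact: fset_uniq.
move=> k; rewrite in_fset_set// notin_setE /=.
by move=> /negP/negPn/eqP.
Qed.

Lemma finsupp_support2 f g :
  exists r, [/\ uniq r, supported_by r f & supported_by r g].
Proof.
have [r _ rf] := finsupp_support f; have [s _ sg] := finsupp_support g.
exists (undup (r ++ s)); split=> [|k|k]; first exact: undup_uniq.
- by rewrite mem_undup mem_cat => /norP[/rf].
- by rewrite mem_undup mem_cat => /norP[_ /sg].
Qed.

Lemma finsuppD f g k : (f + g) k = f k + g k. Proof. by []. Qed.
Lemma finsuppN f k : (- f) k = - f k. Proof. by []. Qed.
Lemma finsuppZ (a : R) f k : (a *: f) k = a * f k. Proof. by []. Qed.

Lemma supported_byD r f g :
  supported_by r f -> supported_by r g -> supported_by r (f + g).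
Proof. by move=> rf rg k kr; rewrite finsuppD rf// rg// addr0. Qed.

Lemma supported_byZ r (a : R) f : supported_by r f -> supported_by r (a *: f).
Proof. by move=> rf k kr; rewrite finsuppZ rf// mulr0. Qed.

Lemma supported_byN r f : supported_by r f -> supported_by r (- f).
Proof. by move=> rf k kr; rewrite finsuppN rf// oppr0. Qed.

Definition l1norm f : R := \sum_(k \in [set: K]) `|f k|.

Lemma l1norm_seq r f : uniq r -> supported_by r f ->
  l1norm f = \sum_(k <- r) `|f k|.
Proof. by move=> ur rf; apply: fsum_seq => // k /rf ->; rewrite normr0. Qed.

Lemma l1normD f g : l1norm (f + g) <= l1norm f + l1norm g.
Proof.
have [r [ur rf rg]] := finsupp_support2 f g.
rewrite !(l1norm_seq ur)//; last exact: supported_byD.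
by rewrite -big_split; apply: ler_sum => k _; exact: ler_normD.
Qed.

Lemma l1normZ (a : R) f : l1norm (a *: f) = `|a| * l1norm f.
Proof.
have [r ur rf] := finsupp_support f.
rewrite !(l1norm_seq ur)//; last exact: supported_byZ.
by rewrite mulr_sumr; apply: eq_bigr => k _; rewrite finsuppZ normrM.
Qed.

Lemma coord_le_l1norm f k : `|f k| <= l1norm f.
Proof.
have [r ur rf] := finsupp_support f; rewrite (l1norm_seq ur)//.
have [kr|/rf ->] := boolP (k \in r); last by rewrite normr0 sumr_ge0.
by rewrite (big_rem k)//= lerDl sumr_ge0.
Qed.

Lemma l1norm_eq0 f : l1norm f = 0 -> f = 0.
Proof.
move=> f0; apply/val_inj/funext => k /=; apply/eqP; rewrite -normr_le0 -f0.
exact: coord_le_l1norm.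
Qed.

HB.instance Definition _ :=
  @Lmodule_isNormed.Build R finsupp l1norm l1normD l1normZ l1norm_eq0.

Lemma finsupp_normE f : `|f| = l1norm f. Proof. by []. Qed.

Lemma finsupp_dist_seq r f g : uniq r -> supported_by r f -> supported_by r g ->
  `|f - g| = \sum_(k <- r) `|f k - g k|.
Proof.
move=> ur rf rg; apply: l1norm_seq ur _.
by apply: supported_byD => //; exact: supported_byN.
Qed.

Lemma delta_subproof k : (fun j => (j == k)%:R : R^o) \in finsupp_pred.
Proof.
apply/asboolP; apply: sub_finite_set (finite_set1 k) => j /=.
by have [->//|_] := eqVneq j k; rewrite eqxx.
Qed.

Definition delta k := Finsupp (delta_subproof k).

Lemma deltaE k j : delta k j = (j == k)%:R. Proof. by []. Qed.

Lemma delta_supp k : supported_by [:: k] (delta k).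
Proof. by move=> j; rewrite inE deltaE => /negPf ->. Qed.

Lemma delta_norm k : `|delta k| = 1.
Proof.
by rewrite finsupp_normE (l1norm_seq _ (@delta_supp k))// big_seq1 deltaE eqxx normr1.
Qed.

Lemma finsupp_sum (s : seq K) (F : K -> finsupp) j :
  (\sum_(k <- s) F k) j = \sum_(k <- s) F k j.
Proof. by apply: (big_morph (fun f : finsupp => f j)). Qed.

Lemma finsupp_generated f : exists s : seq (R * K), f = \sum_(p <- s) p.1 *: delta p.2.
Proof.
have [r ur rf] := finsupp_support f.
exists [seq (f k, k) | k <- r].
transitivity (\sum_(k <- r) f k *: delta k); last by rewrite big_map.
apply/val_inj/funext => j; rewrite -[LHS]/(f j).
rewrite -[RHS]/((\sum_(k <- r) f k *: delta k : finsupp) j) finsupp_sum.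
have [jr|jr] := boolP (j \in r).
  rewrite (bigD1_seq j jr ur) finsuppZ deltaE eqxx mulr1 big1 => [|k kj].
    by rewrite /= addr0.
  by rewrite finsuppZ deltaE eq_sym (negPf kj) mulr0.
rewrite rf// big_seq big1// => k kr; rewrite finsuppZ deltaE.
by rewrite (_ : j == k = false) ?mulr0//; apply: contraNF jr => /eqP->.
Qed.

Lemma density_finsupp : infinite_set [set: K] -> density_le finsupp K.
Proof. by move=> Kinf; exact: density_le_generated finsupp_generated. Qed.

(** The part of the l1 norm of [f] that lies above height [t].  It is what the
    refinement of a cover compares coordinates with: a bound from below on
    [excess t f] for small [t] survives small perturbations of [f], whereas no
    single coordinate of [f] is bounded below by a fixed part of the norm. *)
Definition excess (t : R) f : R := \sum_(k \in [set: K]) Num.max (`|f k| - t) 0.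

Lemma excess_seq t r f : 0 <= t -> uniq r -> supported_by r f ->
  excess t f = \sum_(k <- r) Num.max (`|f k| - t) 0.
Proof.
move=> t0 ur rf; apply: fsum_seq => // k /rf ->.
by rewrite normr0 sub0r; apply/max_idPr; rewrite oppr_le0.
Qed.

Lemma excess_le_dist t f g : 0 <= t -> excess t f <= excess t g + `|f - g|.
Proof.
move=> t0; have [r [ur rf rg]] := finsupp_support2 f g.
rewrite !(excess_seq t0 ur)// (finsupp_dist_seq ur)//.
rewrite -big_split; apply: ler_sum => k _ /=.
have := ler_distD (g k) (f k) 0; rewrite !subr0 => fg.
rewrite ge_max; apply/andP; split; last by rewrite addr_ge0// le_max lexx orbT.
have : `|g k| - t <= Num.max (`|g k| - t) 0 by rewrite le_max lexx.
lra.
Qed.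

(** Each of the finitely many coordinates in the support of [f] loses at most
    [`|s - t|]. *)
Lemma excess_lip (t s : R) r f : 0 <= t -> 0 <= s -> uniq r -> supported_by r f ->
  excess t f <= excess s f + (size r)%:R * `|s - t|.
Proof.
move=> t0 s0 ur rf; rewrite !(excess_seq _ ur)//.
have -> : (size r)%:R * `|s - t| = \sum_(k <- r) `|s - t|.
  by rewrite big_const_seq count_predT iter_addr_0 mulr_natl.
rewrite -big_split; apply: ler_sum => k _ /=.
rewrite ge_max; apply/andP; split; last by rewrite addr_ge0// le_max lexx orbT.
have : `|f k| - s <= Num.max (`|f k| - s) 0 by rewrite le_max lexx.
have := ler_norm (s - t); lra.
Qed.

(** Where [f] exceeds [t] the vector [z] vanishes, and there [`|f - z|] dominates
    [`|f|]. *)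
Lemma excess_near (t : R) f z : 0 <= t -> (forall k, z k != 0 -> `|f k| <= t) ->
  excess t f <= `|f - z|.
Proof.
move=> t0 ft; have [r [ur rf rz]] := finsupp_support2 f z.
rewrite !(excess_seq t0 ur)// (finsupp_dist_seq ur)//.
apply: ler_sum => k _; rewrite ge_max normr_ge0 andbT.
have [->|/ft fk] := eqVneq (z k) 0; first by rewrite subr0 gerBl.
by apply: le_trans (normr_ge0 _); rewrite subr_le0.
Qed.

End finsupp.

(** * Locally finite refinements from selections *)

Lemma seq_argmax (R : realType) (K : eqType) (r : seq K) (P : pred K) (g : K -> R) :
  has P r -> exists2 k, P k & forall j, j \in r -> P j -> g j <= g k.
Proof.
elim: r => //= a r IHr.
have [/IHr[k Pk kmax] _|nP] := boolP (has P r).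
  have [Pa|nPa] := boolP (P a); last first.
    exists k => // j; rewrite inE => /predU1P[-> Pa|/kmax//].
    by rewrite Pa in nPa.
  have [gak|gka] := leP (g a) (g k).
    by exists k => // j; rewrite inE => /predU1P[->//|/kmax].
  exists a => // j; rewrite inE => /predU1P[->//|/kmax h /h hj].
  exact: le_trans (ltW gka).
rewrite orbF => Pa; exists a => // j; rewrite inE => /predU1P[->//|jr Pj].
by move: nP => /hasPn /(_ j jr); rewrite Pj.
Qed.

Section refinement.
Variables (R : realType) (K : choiceType) (X : topologicalType) (u : K -> set X).
Hypotheses (uopen : forall k, open (u k)).
Local Notation E := (finsupp R K).

(** The convex hull of the unit vectors whose index [k] satisfies [u k x]. *)
Definition cover_simplex (x : X) : set E :=
  [set z : E | [/\ forall k, 0 <= z k, `|z| = 1 & forall k, z k != 0 -> u k x]].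

Definition near_simplex : set (X * E) :=
  [set p | exists2 z : E, cover_simplex p.1 z & `|p.2 - z| < 4^-1].

Lemma near_simplex_valued : (forall x, exists k, u k x) -> set_valued near_simplex.
Proof.
move=> ucov x; have [k ukx] := ucov x.
exists (delta R k); apply/mem_set; exists (delta R k); last first.
  by rewrite subrr normr0 invr_gt0.
split; [by move=> j; rewrite deltaE ler0n|exact: delta_norm|].
by move=> j; rewrite deltaE; have [->|_] := eqVneq j k; rewrite ?eqxx.
Qed.

Lemma near_simplex_convex : convex_valued near_simplex.
Proof.
move=> x y1 y2 l /set_mem/set_mem[z1 [z1_ge0 z1n z1u] yz1].
move=> /set_mem/set_mem[z2 [z2_ge0 z2n z2u] yz2].
have l0 : 0 <= l%:num by rewrite ge0.
have l1 : 0 <= 1 - l%:num by rewrite subr_ge0 le1.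
apply/mem_set/mem_set; exists (l%:num *: z1 + (1 - l%:num) *: z2 : E); last first.
  rewrite [X in X - _](_ : _ = l%:num *: (y1 : E) + (1 - l%:num) *: (y2 : E))//.
  rewrite opprD addrACA -!scalerBr.
  apply: le_lt_trans (ler_normD _ _) _; rewrite !normrZ !ger0_norm//.
  have h1 := @convex_lt R `|(y1 : E) - z1| `|(y2 : E) - z2| 4^-1 l%:num.
  by apply: h1 => //; rewrite ge0 le1.
split=> [k||k].
- by rewrite finsuppD !finsuppZ addr_ge0// mulr_ge0.
- have [r [ur rz1 rz2]] := finsupp_support2 z1 z2.
  move: z1n z2n; rewrite !finsupp_normE !(l1norm_seq ur)//; last first.
    by apply: supported_byD; exact: supported_byZ.
  move=> z1n z2n.
  rewrite (eq_bigr (fun k => l%:num * `|z1 k| + (1 - l%:num) * `|z2 k|)).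
    by rewrite big_split -!mulr_sumr z1n z2n /= !mulr1 addrC subrK.
  move=> k _; rewrite finsuppD !finsuppZ ger0_norm ?addr_ge0 ?mulr_ge0//.
  by rewrite !ger0_norm.
- rewrite finsuppD !finsuppZ.
  have [z1k|/z1u //] := eqVneq (z1 k) 0.
  have [z2k|/z2u //] := eqVneq (z2 k) 0.
  by rewrite z1k z2k !mulr0 addr0 eqxx.
Qed.

(** A point of the simplex over [x0] involves finitely many indices, so it also
    lies in the simplex over every point close to [x0]. *)
Lemma near_simplex_open : open near_simplex.
Proof.
rewrite openE => -[x0 y0] [/= z [z0 zn zu] yz].
have [r _ rz] := finsupp_support z.
have Nx : \forall x \near x0, forall k, k \in r -> z k != 0 -> u k x.
  elim: r {rz} => [|k r IHr]; first by apply: nearW.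
  have Nk : \forall x \near x0, z k != 0 -> u k x.
    have [_|/zu ukx] := eqVneq (z k) 0; first exact: nearW.
    by apply: filterS (open_nbhs_nbhs (conj (uopen k) ukx)).
  apply: filterS (filterI Nk IHr) => x [ukx uxr] j.
  by rewrite inE => /predU1P[->//|/uxr].
have d0 : 0 < 4^-1 - `|y0 - z| by rewrite subr_gt0.
exists ([set x | forall k, k \in r -> z k != 0 -> u k x], ball y0 (4^-1 - `|y0 - z|)).
  by split=> //=; exact: nbhsx_ballx.
move=> [x y] [/= ux]; rewrite -ball_normE /= => y0y; exists z => /=.
  split=> // k zk; apply: ux => //.
  by apply: contraT => /rz zk0; rewrite zk0 eqxx in zk.
rewrite -(subrK y0 y) -addrA; apply: le_lt_trans (ler_normD _ _) _.
by rewrite distrC -ltrBrDr.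
Qed.

Variable f : X -> E.
Hypotheses (f_continuous : continuous f) (f_sel : selection near_simplex f).

(** The excess condition replaces a comparison of [`|f x k|] with the largest
    coordinate whose index [j] satisfies [u j x]: that maximum is only lower
    semicontinuous in [x], and the sets would not be open. *)
Definition excess_refinement (k : K) : set X :=
  u k `&` [set x | excess `|f x k| (f x) < 4^-1].

Lemma selection_simplex x : exists2 z : E, cover_simplex x z & `|f x - z| < 4^-1.
Proof. by have /set_mem := f_sel x. Qed.

Lemma selection_near x (e : R) : 0 < e -> \forall y \near x, `|f x - f y| < e.
Proof.
move=> e0; have /f_continuous : nbhs (f x) (ball (f x) e) by exact: nbhsx_ballx.
by rewrite -ball_normE.
Qed.

(** Take [z] in the simplex over [x] close to [f x], and among the indices of the
    support of [z] one at which [f x] is largest: all higher coordinates of [f x]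
    are then outside of the support of [z]. *)
Lemma excess_refinement_cover x : exists k, excess_refinement k x.
Proof.
have [z [z0 zn zu] fz] := selection_simplex x.
have [r _ rz] := finsupp_support z.
suff [k zk kmax] : exists2 k, z k != 0 & forall j, z j != 0 -> `|f x j| <= `|f x k|.
  exists k; split; first exact: zu.
  by apply: le_lt_trans fz; exact: excess_near.
have [k0 zk0] : exists k, z k != 0.
  apply: contrapT => nz.
  suff z_0 : z = 0 by move: zn; rewrite z_0 normr0 => /eqP; rewrite eq_sym oner_eq0.
  apply/val_inj/funext => k /=; apply: contrapT => /eqP zk.
  by apply: nz; exists k.
have rz' k : z k != 0 -> k \in r by apply: contraR => /rz ->.
have [|k zk kmax] := @seq_argmax R K r (fun k => z k != 0) (fun k => `|f x k|).
  by apply/hasP; exists k0 => //; exact: rz'.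
by exists k => // j zj; apply: kmax => //; exact: rz'.
Qed.

(** The excess is continuous in both the height and the vector, since each [f x]
    has finite support. *)
Lemma excess_refinement_open k : open (excess_refinement k).
Proof.
rewrite openE => x [ukx /= ex].
have [r ur rf] := finsupp_support (f x).
pose e := (4^-1 - excess `|f x k| (f x)) / (size r).+1%:R.
have e0 : 0 < e by rewrite divr_gt0 ?subr_gt0 ?ltr0n.
apply: filterS (filterI (open_nbhs_nbhs (conj (uopen k) ukx)) (selection_near x e0)).
move=> y [uky fxy]; split=> //=.
have h1 := excess_le_dist (f y) (f x) (normr_ge0 (f y k)).
have h2 := excess_lip (normr_ge0 (f y k)) (normr_ge0 (f x k)) ur rf.
have h3 : `| `|f x k| - `|f y k| | <= `|f x - f y|.
  apply: le_trans (ler_dist_dist _ _) _.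
  exact: (coord_le_l1norm (f x - f y)).
have h4 : (size r).+1%:R * `|f x - f y| < 4^-1 - excess `|f x k| (f x).
  by rewrite mulrC -ltr_pdivlMr ?ltr0n.
have h5 : (size r)%:R * `| `|f x k| - `|f y k| | <= (size r)%:R * `|f x - f y|.
  by rewrite ler_wpM2l.
rewrite distrC in h1; rewrite -natr1 mulrDl mul1r in h4; lra.
Qed.

(** The norm of [f x] is at least 3/4 and its support is finite, so for a small
    [e] and all [y] near [x] the excess of [f y] over any height less than [e] is
    more than 1/4.  Hence [y] in [excess_refinement k] forces
    [`|f y k| >= e], and then [k] is in the support of [f x]. *)
Lemma excess_refinement_locally_finite (x : X) : exists2 N : set X, nbhs x N &
  finite_set [set k | excess_refinement k `&` N !=set0].
Proof.
have [r ur rf] := finsupp_support (f x).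
(* Raising the height from 0 to at most [e] and moving [f x] by less than [e]
   cost together at most 1/8, less than the gap between 3/4 and 1/4. *)
pose e : R := 8^-1 / (size r).+1%:R.
have e0 : 0 < e by rewrite divr_gt0 ?ltr0n.
exists [set y | `|f x - f y| < e]; first exact: selection_near.
apply: sub_finite_set (finite_seq r) => k [y [[uky /= ey] fxy]] /=.
apply: contraT => /rf fxk.
have fyk : `|f y k| < e.
  apply: le_lt_trans fxy; rewrite -[f y k]subr0 -fxk distrC.
  exact: (coord_le_l1norm (f x - f y)).
have [z [_ zn _] fz] := selection_simplex x.
have h0 : 1 - 4^-1 <= `|f x|.
  have := ler_normD (z - f x) (f x); rewrite subrK zn distrC => h.
  lra.
have h1 := excess_le_dist (f x) (f y) (normr_ge0 (f y k)).
have h2 := excess_lip (lexx 0) (normr_ge0 (f y k)) ur rf.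
rewrite subr0 normr_id in h2.
have h3 : excess 0 (f x) = `|f x|.
  rewrite (excess_seq (lexx 0) ur rf) finsupp_normE (l1norm_seq ur rf).
  by apply: eq_bigr => j _; rewrite subr0; apply/max_idPl.
have h4 : (size r)%:R * `|f y k| + e <= 8^-1.
  have -> : 8^-1 = (size r)%:R * e + e.
    by rewrite -[X in _ + X]mul1r -mulrDl natr1 mulrC /e divfK ?pnatr_eq0.
  by rewrite lerD2r ler_wpM2l// ltW.
lra.
Qed.

End refinement.

(** The open cover is indexed by [K] itself, with repetitions, so that the space of
    finitely supported functions on [K] serves for all covers. *)
Lemma paracompact_of_selection (R : realType) (K : Type) (X : topologicalType) :
  infinite_set [set: K] ->
  selection_property K X (finsupp R {classic K}) -> tau_paracompact K X.
Proof.
move=> Kinf sel U [Uopen Ucov] UK; have [k0 _] := infinite_setN0 Kinf.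
(* The empty cover cannot be indexed by [K]; it is its own refinement. *)
have [U0|/set0P[A0 UA0]] := eqVneq U set0.
  exists U; rewrite U0; split=> //.
  - by split=> //; rewrite -U0.
  - move=> x; exists setT; first exact: filterT.
    by rewrite (_ : [set _ | _] = set0) // -subset0 => B [].
have /(card_le_injP _ _ k0)[i _ ii] := UK.
have /boolp.choice[u uP] : forall k : {classic K}, exists A, U A /\
    forall B, U B -> i B = k -> B = A.
  move=> k; have [[A [UA ik]]|nk] := pselect (exists A, U A /\ i A = k).
    by exists A; split=> // B UB iB; apply: ii; rewrite ?inE// iB ik.
  by exists A0; split=> // B UB iB; case: nk; exists B.
have uopen k : open (u k) by apply: Uopen; have [] := uP k.
have ucov x : exists k, u k x.
  have [B UB Bx] : cover U id x by rewrite Ucov.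
  exists (i B); have [_ /(_ B UB erefl) <-] := uP (i B); exact: Bx.
have [||||f cf f_sel] := sel (@norm_hausdorff _ _) _ (near_simplex (R := R) u).
- exact: density_finsupp.
- exact: near_simplex_valued.
- exact: near_simplex_convex.
- exact: near_simplex_open.
exists (range (excess_refinement u f)); split.
- split=> [_ [k _ <-]|]; first exact: excess_refinement_open.
  apply/seteqP; split=> // x _; have [k kx] := excess_refinement_cover f_sel x.
  by exists (excess_refinement u f k) => //; exists k.
- by move=> _ [k _ <-]; exists (u k); [have [] := uP k|move=> x []].
- move=> x; have [N Nx fN] := excess_refinement_locally_finite cf f_sel x.
  exists N => //; apply: sub_finite_set (finite_image (excess_refinement u f) fN).
  by move=> _ [[k _ <-] BN]; exists k.
Qed.

Theorem theorem1p1 (R : realType) (K : Type) (X : topologicalType)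
    (K_infinite : infinite_set [set: K]) (X_hausdorff : hausdorff_space X) :
  tau_paracompact K X /\ normal_space X <->
  (forall E : topologicalLmodType R,
     hausdorff_space E -> density_le E K ->
     forall Phi : set (X * E),
       set_valued Phi -> convex_valued Phi -> open Phi ->
       exists2 f : X -> E, continuous f & selection Phi f).
Proof.
split=> [[Xpara Xnormal] E _ dE Phi Phi_val Phi_conv Phi_open|sel].
  exact: selection_of_paracompact Xpara Xnormal dE Phi_val Phi_open.
split; first by apply: paracompact_of_selection (sel (finsupp R {classic K})).
exact: normal_of_selection (sel R^o).
Qed.
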